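(* Let $\mathcal{X}$ and $\mathcal{Y}$ be sets, let $A \subseteq \mathbb{R}^m$ be a convex set, and let $f : \mathcal{Y}\times A \to \mathbb{R}$. Let $S, d \ge 1$ be integers, let $\mathbf{q} : \mathcal{X} \to \mathbb{R}^d$ be any map, let $\mathbf{k}_1,\dots,\mathbf{k}_S \in \mathbb{R}^d$ and $\mathbf{v}_1,\dots,\mathbf{v}_S \in \mathcal{Y}$, and define the softmax-attention function $g : \mathcal{X}\times A \to \mathbb{R}$ by $$g(\mathbf{x},\mathbf{a}) = \sum_{s=1}^S \frac{\exp\left(\mathbf{q}(\mathbf{x})^\top \mathbf{k}_s/\sqrt{d}\right)}{\sum_{r=1}^S \exp\left(\mathbf{q}(\mathbf{x})^\top \mathbf{k}_r/\sqrt{d}\right)}\, f(\mathbf{v}_s,\mathbf{a}).$$ If for every $\mathbf{y}\in\mathcal{Y}$ the function $\mathbf{a}\mapsto f(\mathbf{y},\mathbf{a})$ is convex on $A$, then for every $\mathbf{x}\in\mathcal{X}$ the function $\mathbf{a}\mapsto g(\mathbf{x},\mathbf{a})$ is convex on $A$.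
   Context: Here $f(\mathbf{y},\mathbf{a})$ is the cost of decision $\mathbf{a}$ under problem parameter $\mathbf{y}$, $\mathbf{x}$ is an input feature, $\mathbf{q}$ is the encoder (query map), $\mathbf{k}_s$ are the key embeddings and $\mathbf{v}_s$ are the value embeddings (elements of the domain of $\mathbf{y}$). The function $g$ is the attention-based model for the expected cost, equal to the dot product of $\mathrm{Softmax}\left(\left[\mathbf{q}(\mathbf{x})^\top\mathbf{k}_1/\sqrt{d},\dots,\mathbf{q}(\mathbf{x})^\top\mathbf{k}_S/\sqrt{d}\right]\right)$ with the vector $[f(\mathbf{v}_1,\mathbf{a}),\dots,f(\mathbf{v}_S,\mathbf{a})]$. *)

(* Defs.v *)
(* MathComp-Analysis *)
From mathcomp Require Import all_boot all_order all_algebra.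
From mathcomp Require Import classical_sets reals sequences exp convex.

Set Implicit Arguments.
Unset Strict Implicit.
Unset Printing Implicit Defensive.

Import Order.TTheory GRing.Theory Num.Theory.
Local Open Scope ring_scope.

Definition softmax (R : realType) (S : nat) (z : 'I_S -> R) (s : 'I_S) : R :=
  expR (z s) / \sum_(r < S) expR (z r).

(* The entry of the 1 x 1 matrix u^T *m w is the dot product of u and w. *)
Definition scaled_dot (R : realType) (d : nat) (u w : 'cV[R]_d) : R :=
  (u^T *m w) ord0 ord0 / Num.sqrt d%:R.

(* A cost f : Y * A -> R with A a subset of R^m is represented by a function
   that is total in its second argument; its values outside A are irrelevant. *)
Definition attention_cost (R : realType) (X Y : Type) (m S d : nat)
    (f : Y -> 'cV[R]_m -> R) (q : X -> 'cV[R]_d)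
    (k : 'I_S -> 'cV[R]_d) (v : 'I_S -> Y) (x : X) (a : 'cV[R]_m) : R :=
  \sum_(s < S) softmax (fun r => scaled_dot (q x) (k r)) s * f (v s) a.

(* Main.v *)
Require Import Defs.
From mathcomp Require Import all_boot all_order all_algebra.
From mathcomp Require Import classical_sets reals sequences exp convex.

Set Implicit Arguments.
Unset Strict Implicit.
Unset Printing Implicit Defensive.

Import Order.TTheory GRing.Theory Num.Theory.
Local Open Scope ring_scope.

(** For fixed [x] the attention weights are nonnegative ([softmax_ge0]) and do not depend on [a].
    The cost is thus a nonnegative combination of the convex functions [f (v s)], and such
    combinations stay convex ([convex_function_sum]). *)

Lemma softmax_ge0 (R : realType) (S : nat) (z : 'I_S -> R) (s : 'I_S) :
  0 <= softmax z s.
Proof. by rewrite divr_ge0 ?expR_ge0 ?sumr_ge0 // => r _; exact: expR_ge0. Qed.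

Lemma convex_function_sum (R : realType) (E : lmodType R) (I : finType)
    (A : set (convex_lmodType E)) (w : I -> R) (g : I -> E -> R) :
  (forall i, 0 <= w i) -> (forall i, convex_function A (g i)) ->
  convex_function A (fun a => \sum_i w i * g i a).
Proof.
move=> w0 cg t a b aA bA.
rewrite convRE !mulr_sumr -big_split /= ler_sum // => i _.
(* With both sides now compared term by term, [w i] factors out of each; as it is nonnegative, the
   convexity inequality of [g i] suffices. *)
rewrite !(mulrCA _ (w i)) -mulrDr ler_wpM2l //.
by have := cg i t a b aA bA; rewrite convRE.
Qed.

Theorem proposition3 (R : realType) (X Y : Type) (m S d : nat)
    (A : set 'cV[R]_m) (f : Y -> 'cV[R]_m -> R)
    (q : X -> 'cV[R]_d) (k : 'I_S -> 'cV[R]_d) (v : 'I_S -> Y)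
    (hA : convex_set (M := 'cV[R]_m) A)
    (hS : (1 <= S)%N) (hd : (1 <= d)%N)
    (hf : forall y : Y, convex_function (E := 'cV[R]_m) A (fun a => f y a)) :
  forall x : X,
    convex_function (E := 'cV[R]_m) A (fun a => attention_cost f q k v x a).
Proof.
(* Fixing [x] turns the softmax values into constant weights. *)
by move=> x; apply: convex_function_sum => [s|s]; [exact: softmax_ge0 | exact: hf].
Qed.
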